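(* Let $u,v$ be rational functions with $u(n)>0$ for all integers $n\ge 2$, and let $\{a_n\}_{n\geq 0}$ be a sequence of positive real numbers satisfying $a_n=u(n)a_{n-1}+v(n)a_{n-2}$ for $n\ge 2$. Assume $v(n)<0$ for all $n\geq 2$. If there exist a nonnegative integer $N$ and a function $h$ such that for all $n\geq N+2$: (i) $3u(n)/4\leq a_n/a_{n-1}\leq h(n)$; and (ii) $h(n)^4-u(n)h(n)^3-u(n+1)v(n)h(n)-v(n)v(n+1)< 0$, then the sequence $\{a_n\}_{n\geq N}$ is ratio log-concave.
   Context: A sequence $(x_n)_{n\ge m}$ of positive reals is log-concave if $x_n^2\ge x_{n-1}x_{n+1}$ for all $n\ge m+1$. A sequence $(a_n)_{n\ge m}$ of positive reals is ratio log-concave if $(a_{n+1}/a_n)_{n\ge m}$ is log-concave. *)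

(* Defs.v *)
From HB Require Import structures.
From mathcomp Require Import all_boot all_order all_algebra.
From mathcomp Require Import generic_quotient fraction.
From mathcomp Require Import reals.

Set Implicit Arguments.
Unset Strict Implicit.
Unset Printing Implicit Defensive.

Import Order.TTheory GRing.Theory Num.Theory.

Local Open Scope ring_scope.
Local Open Scope quotient_scope.

(* The value at x of a rational function, computed on a representative in
   lowest terms, so that only genuine poles matter.  At a pole the value is 0
   (by the convention 0^-1 = 0); hence a nonzero value at x implies that x is
   not a pole. *)
Definition ratfun_eval (F : fieldType) (f : {fraction {poly F}}) (x : F) : F :=
  let p := \n_(repr f) in
  let q := \d_(repr f) in
  (p %/ gcdp p q).[x] / (q %/ gcdp p q).[x].

Lemma ratfun_evalE (F : fieldType) (p q : {poly F}) (x : F) :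
  q.[x] != 0 ->
  ratfun_eval (FracField.tofrac p / FracField.tofrac q) x = p.[x] / q.[x].
Proof.
move=> qx0; have q0 : q != 0 by apply: contraNneq qx0 => ->; rewrite horner0.
set f := _ / _; rewrite /ratfun_eval.
set n := \n_(repr f); set d := \d_(repr f).
have d0 : d != 0 by apply: denom_ratioP.
have fE : f = FracField.tofrac n / FracField.tofrac d.
  have dF0 : FracField.tofrac d != 0 by rewrite tofrac_eq0.
  apply: (mulIf dF0); rewrite divfK //.
  rewrite -[f]reprK !piE; apply/eqP; rewrite FracField.equivf_def /=.
  rewrite /FracField.mulf (numer_Ratio n) ?oner_neq0 // (denom_Ratio n) ?oner_neq0 //.
  rewrite (numer_Ratio d) ?oner_neq0 // (denom_Ratio d) ?oner_neq0 //.
  rewrite -/n -/d !mulr1 (numer_Ratio (n * d) d0) (denom_Ratio (n * d) d0).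
  by rewrite mulrC.
have nq : n * q = p * d.
  have qF0 : FracField.tofrac q != 0 by rewrite tofrac_eq0.
  have dF0 : FracField.tofrac d != 0 by rewrite tofrac_eq0.
  have e1 : f * FracField.tofrac q = FracField.tofrac p by exact: (divfK qF0).
  have e2 : f * FracField.tofrac d = FracField.tofrac n.
    by rewrite [in LHS]fE; exact: (divfK dF0).
  apply/eqP; rewrite -(tofrac_eq (n * q)); apply/eqP.
  by rewrite (tofracM n) (tofracM p) -e1 -e2 mulrAC.
set g := gcdp n d.
have g0 : g != 0 by rewrite gcdp_eq0 negb_and d0 orbT.
have nE : n = n %/ g * g by rewrite divpK // dvdp_gcdl.
have dE : d = d %/ g * g by rewrite divpK // dvdp_gcdr.
have cop : coprimep (n %/ g) (d %/ g).
  by apply: coprimep_div_gcd; rewrite d0 orbT.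
have nq' : n %/ g * q = p * (d %/ g).
  by apply: (mulIf g0); rewrite -[RHS]mulrA -dE -nq mulrAC -nE.
have dq : d %/ g %| q.
  rewrite -(@Gauss_dvdpr _ q (n %/ g) (d %/ g)) 1?coprimep_sym //.
  by rewrite nq' dvdp_mull.
have dx0 : (d %/ g).[x] != 0.
  by apply: contraNneq qx0 => e; case/dvdpP: dq => r ->; rewrite hornerM e mulr0.
by apply/eqP; rewrite eqr_div // -!hornerM nq'.
Qed.

Definition log_concave_from (R : realType) (m : nat) (x : nat -> R) : Prop :=
  (forall n, (m <= n)%N -> 0 < x n) /\
  (forall n, (m + 1 <= n)%N -> x n ^+ 2 >= x n.-1 * x n.+1).

Definition ratio_log_concave_from (R : realType) (m : nat) (a : nat -> R) : Prop :=
  (forall n, (m <= n)%N -> 0 < a n) /\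
  log_concave_from m (fun n => a n.+1 / a n).

(* Main.v *)
Require Import Defs.
From mathcomp Require Import all_boot all_order all_algebra.
From mathcomp Require Import fraction reals.
From mathcomp Require Import ring lra.

Import Order.TTheory GRing.Theory Num.Theory.

Local Open Scope ring_scope.

(** Put [x = a_n / a_(n-1)] and
    [f(y) = y^4 - u(n) y^3 - u(n+1) v(n) y - v(n) v(n+1)].  The recurrence
    expresses the neighbouring ratios through [x], namely
    [a_(n-1) / a_(n-2) = - v(n) / (u(n) - x)] and
    [a_(n+1) / a_n = u(n+1) + v(n+1) / x], so log-concavity of the ratios at
    this place is [f(x) <= 0].  Since [f'(y) = (4y - 3u(n)) y^2 - u(n+1) v(n)]
    is positive for [y >= 3u(n)/4], [f] is increasing there, and
    [f(x) <= f(h(n)) < 0]. *)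

Definition ratio_quartic {R : realFieldType} (u u' v v' y : R) : R :=
  y ^+ 4 - u * y ^+ 3 - u' * v * y - v * v'.

(** No derivative is taken: the difference of the two values is [y - x] times a sum of three terms,
    each nonnegative under the hypotheses. *)
Lemma ratio_quartic_homo (R : realFieldType) (u u' v v' x y : R) :
  0 <= u' -> v <= 0 -> 0 <= x -> 3 * u / 4 <= x -> x <= y ->
  ratio_quartic u u' v v' x <= ratio_quartic u u' v v' y.
Proof.
move=> u'0 v0 x0 ux xy; rewrite -subr_ge0.
(* Splitting [u] as [4x/3 - (4x/3 - u)] isolates the bound [3u/4 <= x]; the cubic left over vanishes
   at [y = x], whence the second factor [y - x]. *)
have -> : ratio_quartic u u' v v' y - ratio_quartic u u' v v' x =
    (y - x) * ((y - x) * (y ^+ 2 + 2 / 3 * x * y + x ^+ 2 / 3)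
      + (4 * x / 3 - u) * (y ^+ 2 + y * x + x ^+ 2) + u' * - v).
  by rewrite /ratio_quartic; field.
have y0 : 0 <= y := le_trans x0 xy.
have xy0 : 0 <= x * y by rewrite mulr_ge0.
have sx := sqr_ge0 x; have sy := sqr_ge0 y.
apply: mulr_ge0; first by rewrite subr_ge0.
apply: addr_ge0; last by rewrite mulr_ge0 ?oppr_ge0.
by apply: addr_ge0; apply: mulr_ge0; lra.
Qed.

(** For consecutive terms [p, q, r, s], eliminating [u] and [s] makes the quartic at [r / q] a
    negative multiple of right side minus left side. *)
Lemma ratio_log_concave_quartic (R : realFieldType) (u u' v v' p q r s : R) :
  0 < p -> 0 < q -> 0 < r -> r = u * q + v * p -> s = u' * r + v' * q ->
  v < 0 -> ratio_quartic u u' v v' (r / q) <= 0 ->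
  q / p * (s / r) <= (r / q) ^+ 2.
Proof.
move=> p0 q0 r0 rE sE v0.
have [pn qn rn] : [/\ p != 0, q != 0 & r != 0] by split; rewrite gt_eqF.
have uE : u = (r - v * p) / q by rewrite rE; field.
have -> : ratio_quartic u u' v v' (r / q) =
    v * p * r / q ^+ 2 * ((r / q) ^+ 2 - q / p * (s / r)).
  by rewrite /ratio_quartic uE sE; field; rewrite pn qn rn.
rewrite nmulr_rle0 ?subr_ge0 // -!mulrA nmulr_rlt0 //.
by rewrite !mulr_gt0 ?invr_gt0 ?exprn_gt0.
Qed.

Theorem theorem4p5 (R : realType) (u v : {fraction {poly R}}) (a : nat -> R)
  (u_pos : forall n : nat, (2 <= n)%N -> 0 < ratfun_eval u n%:R)
  (a_pos : forall n : nat, 0 < a n)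
  (a_rec : forall n : nat, (2 <= n)%N ->
     a n = ratfun_eval u n%:R * a (n - 1)%N + ratfun_eval v n%:R * a (n - 2)%N)
  (v_neg : forall n : nat, (2 <= n)%N -> ratfun_eval v n%:R < 0)
  (N : nat) (h : nat -> R)
  (ratio_bounds : forall n : nat, (N + 2 <= n)%N ->
     3 * ratfun_eval u n%:R / 4 <= a n / a (n - 1)%N <= h n)
  (h_ineq : forall n : nat, (N + 2 <= n)%N ->
     h n ^+ 4 - ratfun_eval u n%:R * h n ^+ 3
       - ratfun_eval u (n + 1)%:R * ratfun_eval v n%:R * h n
       - ratfun_eval v n%:R * ratfun_eval v (n + 1)%:R < 0) :
  ratio_log_concave_from N a.
Proof.
split=> [n _ //|]; split=> [n _|[|n]]; first by rewrite divr_gt0.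
  by rewrite addn1.
rewrite addn1 ltnS => Nn /=.
(* Log-concavity at [n + 1] involves [a n] to [a (n + 3)]; its middle ratio is the one bounded at
   index [n + 2]. *)
have Nn2 : (N + 2 <= n.+2)%N by rewrite addn2 !ltnS.
have := h_ineq _ Nn2; have := ratio_bounds _ Nn2; rewrite addn1 subn1 /=.
move=> /andP[ux xh] fh.
have rec2 := a_rec n.+2 isT; have rec3 := a_rec n.+3 isT.
rewrite !subSS !subn0 in rec2 rec3.
apply: (ratio_log_concave_quartic _ _ _ _ _ _ _ _ _ _ _ _ rec2 rec3) => //.
  exact: v_neg.
apply: le_trans (ltW fh); apply: ratio_quartic_homo => //.
- exact/ltW/u_pos.
- exact/ltW/v_neg.
- by rewrite divr_ge0 ?ltW.
Qed.
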